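(* Let $X$ be a Montel space and let $(T(t))_{t\geqslant0}$ be a bounded $C_0$-semigroup on $X$. The following are equivalent. (i) $(T(t))_{t\geqslant0}$ is uniformly stable. (ii) $(T(t))_{t\geqslant0}$ is strongly stable.
   Context: Locally convex spaces are assumed Hausdorff. For a locally convex space $X$, $\Gamma_X$ denotes a system of continuous seminorms determining the topology of $X$, $L(X)$ is the space of all continuous linear operators $X\to X$, and $\mathcal{B}_X$ is the collection of all bounded subsets of $X$. For $q\in\Gamma_X$, $B\in\mathcal{B}_X$ and $S\in L(X)$ put $q_B(S)=\sup_{x\in B}q(Sx)$. $X$ is barrelled if every absolutely convex, absorbing and closed set is a neighborhood of zero. A locally convex space $X$ is a Montel space if $X$ is barrelled and every bounded subset of $X$ is relatively compact. A $C_0$-semigroup on $X$ is a family $(T(t))_{t\geqslant0}\subseteq L(X)$ with $T(0)=\mathrm{id}_X$, $T(s+t)=T(s)T(t)$ for all $s,t\geqslant0$, and $\lim_{t\to t_0}T(t)x=T(t_0)x$ for all $t_0\geqslant0$, $x\in X$. It is bounded if $\forall B\in\mathcal{B}_X, q\in\Gamma_X\ \exists C\geqslant0\ \forall t\geqslant0$: $q_B(T(t))\leqslant C$. It is uniformly stable if $\forall B\in\mathcal{B}_X, q\in\Gamma_X$: $\lim_{t\to\infty}q_B(T(t))=0$, and strongly stable if $\forall x\in X$: $\lim_{t\to\infty}T(t)x=0$. *)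

(* Defs.v *)
From HB Require Import structures.
From mathcomp Require Import all_boot all_order all_algebra.
From mathcomp Require Import complex.
From mathcomp Require Import boolp classical_sets cardinality convex reals.
From mathcomp Require Import topology normedtype.

Set Implicit Arguments.
Unset Strict Implicit.
Unset Printing Implicit Defensive.

Import Order.TTheory GRing.Theory Num.Theory.
Import numFieldNormedType.Exports.

Local Open Scope classical_set_scope.
Local Open Scope ring_scope.

(* Locally convex spaces are real or complex vector spaces; both cases are
   covered by letting the scalar field depend on a parameter. *)
Variant scalar_kind := RealScalars | ComplexScalars.

Definition scalars (R : realType) (k : scalar_kind) : numFieldType :=
  match k with RealScalars => R | ComplexScalars => R[i] end.

(* MathComp norms on a numFieldType take values in the field itself, whereas
   seminorms are real-valued; [modulus] is the real-valued absolute value. *)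
Definition modulus (R : realType) (k : scalar_kind) : scalars R k -> R :=
  match k return scalars R k -> R with
  | RealScalars => fun a : R => `|a|
  | ComplexScalars => fun a : R[i] => complex.Re `|a|
  end.

Section LocallyConvex.
Context (R : realType) (k : scalar_kind) (X : tvsType (scalars R k)).
Implicit Types (A B U : set X) (q : X -> R).

Definition seminorm q : Prop :=
  [/\ forall x, 0 <= q x,
      forall (a : scalars R k) x, q (a *: x) = modulus a * q x
    & forall x y, q (x + y) <= q x + q y].

(* The finite intersections of balls of members of [Gamma] form a basis of
   neighbourhoods of zero; [Gamma] need not be directed. *)
Definition determining_system (Gamma : set (X -> R)) : Prop :=
  (forall q, Gamma q -> seminorm q /\ continuous q) /\
  (forall U, nbhs (0 : X) U ->
     exists F : set (X -> R), [/\ F `<=` Gamma, finite_set F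
       & exists2 e : R, 0 < e & [set x | forall q, F q -> q x < e] `<=` U]).

Definition absorbs U B : Prop :=
  exists2 r : R, 0 < r &
    forall a : scalars R k, r <= modulus a -> B `<=` [set a *: x | x in U].

Definition absorbing A : Prop := forall x, absorbs A [set x].

(* The library's [bounded_set] needs a norm; this is boundedness in a
   topological vector space. *)
Definition bounded_subset B : Prop :=
  forall U, nbhs (0 : X) U -> absorbs U B.

Definition balanced A : Prop :=
  forall (a : scalars R k) x, modulus a <= 1 -> A x -> A (a *: x).

Definition absolutely_convex A : Prop := convex_set A /\ balanced A.

Definition barrelled : Prop :=
  forall A, absolutely_convex A -> absorbing A -> closed A -> nbhs (0 : X) A.

Definition montel : Prop :=
  barrelled /\ (forall B, bounded_subset B -> compact (closure B)).

Record continuous_operator := ContinuousOperator {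
  operator_fun :> {linear X -> X};
  operator_continuous : continuous operator_fun }.

(* [sup] is the real supremum: [sup set0 = 0], so [B = set0] gives 0, and the
   set is bounded above whenever [B] is bounded and [q] is a continuous
   seminorm, as [S] is a continuous operator. *)
Definition sup_seminorm q B (S : continuous_operator) : R :=
  sup [set q (S x) | x in B].

(* A family indexed by t >= 0 is encoded as a function on [R] about whose
   values at negative arguments nothing is assumed. *)
Record C0_semigroup (T : R -> continuous_operator) : Prop := {
  semigroup_id : forall x, T 0 x = x;
  semigroup_add : forall s t : R, 0 <= s -> 0 <= t ->
    forall x, T (s + t) x = T s (T t x);
  semigroup_cvg : forall (t0 : R) x, 0 <= t0 ->
    T t x @[t --> within [set t : R | 0 <= t] (nbhs t0)] --> T t0 x }.

Definition bounded_semigroup (Gamma : set (X -> R))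
    (T : R -> continuous_operator) : Prop :=
  forall B q, bounded_subset B -> Gamma q ->
    exists2 C : R, 0 <= C & forall t : R, 0 <= t -> sup_seminorm q B (T t) <= C.

Definition uniformly_stable (Gamma : set (X -> R))
    (T : R -> continuous_operator) : Prop :=
  forall B q, bounded_subset B -> Gamma q ->
    sup_seminorm q B (T t) @[t --> +oo] --> (0 : R).

Definition strongly_stable (T : R -> continuous_operator) : Prop :=
  forall x, T t x @[t --> +oo] --> (0 : X).

End LocallyConvex.

(* Main.v *)
(* Write [q] for a seminorm of the determining system.  Boundedness of the
   semigroup on singletons makes
   [{x | q (T t x) <= e for all t >= 0}] an absolutely convex, closed and
   absorbing set, hence a neighbourhood of zero because [X] is barrelled.  So
   the semigroup is equicontinuous, and pointwise convergence to zero is then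
   uniform on compact sets, in particular on closures of bounded sets. *)

Require Import Defs.
From mathcomp Require Import all_boot all_order all_algebra.
From mathcomp Require Import complex.
From mathcomp Require Import boolp classical_sets cardinality convex reals.
From mathcomp Require Import interval_inference topology normedtype.

Set Implicit Arguments.
Unset Strict Implicit.
Unset Printing Implicit Defensive.

Import Order.TTheory GRing.Theory Num.Theory.
Import numFieldNormedType.Exports.

Local Open Scope classical_set_scope.
Local Open Scope ring_scope.

Section Modulus.
Context (R : realType) (k : scalar_kind).
Implicit Types a b : scalars R k.

Lemma modulus_ge0 a : 0 <= modulus a.
Proof.
case: k a => a; first exact: normr_ge0.
by have := normr_ge0 a; rewrite lecE => /andP[].
Qed.

Lemma modulus_le a b : (modulus a <= modulus b) = (`|a| <= `|b|).
Proof. by case: k a b => [//|] a b; rewrite lecE /= eqxx. Qed.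

Lemma modulus0 : modulus (0 : scalars R k) = 0.
Proof. by case: k; rewrite /modulus; [exact: normr0|rewrite (normr0 R[i])]. Qed.

Lemma modulus1 : modulus (1 : scalars R k) = 1.
Proof. by case: k; rewrite /modulus; [exact: normr1|rewrite (normr1 R[i])]. Qed.

Lemma modulusM a b : modulus (a * b) = modulus a * modulus b.
Proof.
case: k a b => a b; first exact: normrM.
exact: ComplexField.Normc.normcM.
Qed.

(** In the order of [R[i]], being nonnegative forces a scalar to be real, so no cancellation occurs.
    This turns the scalar weights of a convex combination into real weights with sum 1. *)
Lemma modulusD_ge0 a b : 0 <= a -> 0 <= b ->
  modulus (a + b) = modulus a + modulus b.
Proof.
have addE (K : numDomainType) (x y : K) : 0 <= x -> 0 <= y ->
    `|x + y| = `|x| + `|y|.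
  by move=> x0 y0; rewrite !ger0_norm// addr_ge0.
case: k a b => a b a0 b0; first exact: addE.
by rewrite /modulus [X in complex.Re X](addE R[i])// raddfD.
Qed.

Lemma modulus_eq0 a : modulus a = 0 -> a = 0.
Proof.
move=> a0; apply/eqP; rewrite -normr_le0 -(normr0 (scalars R k)) -modulus_le.
by rewrite a0 modulus0.
Qed.

Lemma modulusV a : modulus a^-1 = (modulus a)^-1.
Proof.
have [->|a0] := eqVneq a 0; first by rewrite invr0 modulus0 invr0.
have ma0 : modulus a != 0 by apply: contra_neq a0 => /modulus_eq0.
by apply: (mulIf ma0); rewrite -modulusM !mulVf// modulus1.
Qed.

(** Lets a real radius supplied by [absorbs] be realised by an actual scalar. *)
Lemma modulus_surj (r : R) : 0 <= r -> exists a, modulus a = r.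
Proof.
case: k => r0; first by exists r; rewrite /= ger0_norm.
exists (r%:C)%C; rewrite [LHS](_ : _ = Num.sqrt (r ^+ 2 + 0 ^+ 2))//.
by rewrite expr0n addr0 sqrtr_sqr ger0_norm.
Qed.

End Modulus.

Section LocallyConvexTheory.
Context (R : realType) (k : scalar_kind) (X : tvsType (scalars R k)).
Implicit Types (q : X -> R) (B : set X) (S : continuous_operator X).

Lemma seminorm0 q : seminorm q -> q 0 = 0.
Proof. by case=> _ qZ _; rewrite -(scale0r 0) qZ modulus0 mul0r. Qed.

Lemma seminorm_near0 q : seminorm q -> continuous q ->
  forall e : R, 0 < e -> \forall x \near (0 : X), q x < e.
Proof.
move=> sq cq e e0; have := cq 0.
rewrite /continuous_at seminorm0// => /cvgr_lt; exact.
Qed.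

(** Scaling is continuous at [(0, x)], so [b *: x] lies in [U] for all small [b]; take [b = a^-1]
    with [a] large. *)
Lemma bounded_set1 (x : X) : bounded_subset [set x].
Proof.
move=> U U0.
have := @scale_continuous _ X (0, x).
rewrite /continuous_at /= scale0r => /(_ U U0) [[V W] /= [V0 Wx] VWU].
have /nbhs_ballP[e /= e0 eV] := V0.
(* Halving turns the non-strict bound on [a^-1] into membership in the open ball of radius [e]. *)
have e20 : 0 < e / 2 by rewrite divr_gt0.
have m0 : 0 < modulus (e / 2)^-1.
  rewrite lt_neqAle modulus_ge0 andbT eq_sym; apply/eqP => /modulus_eq0/eqP.
  by rewrite invr_eq0 gt_eqF.
exists (modulus (e / 2)^-1) => // a ea _ ->.
have a0 : a != 0.
  by apply: contraTneq ea => ->; rewrite modulus0 -ltNge.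
exists (a^-1 *: x); last by rewrite scalerA divff// scale1r.
apply: (VWU (a^-1, x)); split => /=; last exact: nbhs_singleton.
apply: eV; rewrite -ball_normE /= sub0r normrN.
have: modulus a^-1 <= modulus (e / 2).
  rewrite -(invrK (e / 2)) [leRHS]modulusV [leLHS]modulusV.
  by rewrite lef_pV2 ?posrE// (lt_le_trans m0).
rewrite modulus_le (gtr0_norm e20) => /le_lt_trans; apply.
by rewrite ltr_pdivrMr// ltr_pMr// ltr1n.
Qed.

(** The preimage under [S] of the open unit ball of [q] is a neighbourhood of zero; if it absorbs
    [B] with radius [r], then [r] is a bound. *)
Lemma sup_seminorm_has_ubound q B S : seminorm q -> continuous q ->
  bounded_subset B -> has_ubound [set q (S x) | x in B].
Proof.
move=> sq cq bB.
have U0 : nbhs (0 : X) [set x | q (S x) < 1].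
  have := @operator_continuous _ _ _ S 0; rewrite /continuous_at linear0.
  by move/(_ _ (seminorm_near0 sq cq ltr01)).
have [r r0 Br] := bB _ U0.
have [a ar] := modulus_surj k (ltW r0).
exists r => _ [x Bx <-].
have [|y /= qy <-] := Br a _ x Bx; first by rewrite ar.
case: (sq) => _ qZ _.
by rewrite linearZ qZ ar ger_pMr// ltW.
Qed.

Lemma le_sup_seminorm q B S x : seminorm q -> continuous q ->
  bounded_subset B -> B x -> q (S x) <= sup_seminorm q B S.
Proof.
move=> sq cq bB Bx.
by apply: ub_le_sup; [exact: sup_seminorm_has_ubound|exists x].
Qed.

Lemma sup_seminorm_ge0 q B S : seminorm q -> continuous q ->
  bounded_subset B -> 0 <= sup_seminorm q B S.
Proof.
move=> sq cq bB; have [->|/set0P[x Bx]] := eqVneq B set0.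
  by rewrite /sup_seminorm image_set0 sup0.
by apply: le_trans (le_sup_seminorm S sq cq bB Bx); case: sq.
Qed.

(** For empty [B] the supremum is 0 by default, whence [0 <= e]. *)
Lemma sup_seminorm_le q B S (e : R) : 0 <= e ->
  (forall x, B x -> q (S x) <= e) -> sup_seminorm q B S <= e.
Proof.
move=> e0 Be; have [->|/set0P[x Bx]] := eqVneq B set0.
  by rewrite /sup_seminorm image_set0 sup0.
by apply: ge_sup; [exists (q (S x)), x|move=> _ [y By <-]; exact: Be].
Qed.

Lemma determining_system_cvg0 (Gamma : set (X -> R)) (I : Type)
    (F : set_system I) (f : I -> X) : Filter F -> determining_system Gamma ->
  (forall q (e : R), Gamma q -> 0 < e -> \forall i \near F, q (f i) < e) ->
  f i @[i --> F] --> (0 : X).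
Proof.
move=> FF [_ basisGamma] fq U /basisGamma[G [GGamma /finite_fsetP[D GD]]].
case=> e e0 GU.
(* A basic neighbourhood involves only finitely many seminorms, and a filter is closed under finite
   intersections. *)
have near_G : F (\bigcap_(q in G) [set i | q (f i) < e]).
  rewrite GD; apply: filter_bigI => q qD.
  by apply: fq => //; apply: GGamma; rewrite GD.
by apply: (@filterS _ F _ _ (f @^-1` U) _ near_G) => i iG; exact: GU.
Qed.

Section Barrel.
Context (I : Type) (D : set I) (S : I -> continuous_operator X).
Context (q : X -> R) (e : R).
Hypotheses (sq : seminorm q) (cq : continuous q) (e0 : 0 < e).
Let A : set X := [set x | forall i, D i -> q (S i x) <= e].

Lemma sublevel_absolutely_convex : absolutely_convex A.
Proof.
case: sq => q0 qZ qD; split=> [x y l|a x a1 Ax i Di].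
  rewrite !inE => Ax Ay i Di.
  rewrite /conv /= linearD !linearZ; apply: le_trans (qD _ _) _.
  rewrite !qZ; have l0 : 0 <= l%:num by [].
  have l1 : 0 <= 1 - l%:num by rewrite subr_ge0.
  have m1 : modulus l%:num + modulus (1 - l%:num) = 1.
    by rewrite -modulusD_ge0// addrC subrK modulus1.
  rewrite -[leRHS]mul1r -m1 mulrDl lerD// ler_wpM2l ?modulus_ge0//.
    exact: Ax.
  exact: Ay.
rewrite linearZ qZ; apply: le_trans (Ax i Di).
by rewrite ler_piMl.
Qed.

Lemma sublevel_closed : closed A.
Proof.
rewrite (_ : A = \bigcap_(i in D) ((q \o S i) @^-1` [set r | r <= e])); last first.
  by apply/seteqP; split.
apply: closed_bigI => i _; apply: preimage_closed; last exact: closed_le.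
move=> x _; apply: continuous_comp; last exact: cq.
exact: operator_continuous.
Qed.

Lemma sublevel_absorbing :
  (forall x, exists C, forall i, D i -> q (S i x) <= C) -> absorbing A.
Proof.
move=> bS x; have [C SC] := bS x.
(* Dividing [x] by a scalar of modulus at least [C / e] brings the bound [C] down to [e]. The 1
   keeps the radius positive and the scalar nonzero, since [C / e] need not be positive. *)
exists (Num.max 1 (C / e)); first by rewrite lt_max ltr01.
move=> a; rewrite ge_max => /andP[a1 Ca] _ ->.
have m0 : 0 < modulus a by apply: lt_le_trans a1.
have a0 : a != 0 by apply: contraTneq m0 => ->; rewrite modulus0 ltxx.
exists (a^-1 *: x); last by rewrite scalerA divff// scale1r.
case: sq => q0 qZ _ i Di; rewrite linearZ qZ modulusV mulrC ler_pdivrMr//.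
by rewrite mulrC -ler_pdivrMr// (le_trans _ Ca)// ler_pM2r ?invr_gt0 ?SC.
Qed.

(** The Banach-Steinhaus theorem on barrelled spaces, for a single seminorm: the sublevel set [A] is
    a barrel. *)
Lemma barrelled_equicontinuous : barrelled X ->
  (forall x, exists C, forall i, D i -> q (S i x) <= C) -> nbhs 0 A.
Proof.
move=> bX bS; apply: bX; [exact: sublevel_absolutely_convex|
  exact: sublevel_absorbing|exact: sublevel_closed].
Qed.

End Barrel.

(** Near each point [x] of [K], equicontinuity controls the deviation from [S i x] uniformly in [i],
    and compactness leaves finitely many such points to handle. *)
Lemma equicontinuous_near_compact (I : Type) (F : set_system I) (D : set I)
    (S : I -> continuous_operator X) q (K : set X) : Filter F -> F D ->
  seminorm q ->
  (forall e : R, 0 < e ->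
    nbhs 0 [set x | forall i, D i -> q (S i x) <= e]) ->
  (forall x (e : R), 0 < e -> \forall i \near F, q (S i x) < e) ->
  compact K -> forall e : R, 0 < e ->
  \forall i \near F, forall x, K x -> q (S i x) < e.
Proof.
move=> FF FD [_ _ qD] eqS cvgS /compact_near_coveringP cK e e0.
have e20 : 0 < e / 2 by rewrite divr_gt0.
apply: (cK _ _ (fun i x => q (S i x) < e)) => x _.
(* The covering neighbourhood is a translate to [x] of one given by equicontinuity; indices are cut
   down to [D], where that estimate is available. *)
exists ([set x + y | y in [set y | forall i, D i -> q (S i y) <= e / 2]],
        D `&` [set i | q (S i x) < e / 2]) => /=.
  split; first exact/nbhsT/eqS.
  by apply: filterI => //; exact: cvgS.
move=> [_ i] /= [[y yA <-] [Di xe]]; rewrite linearD.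
by rewrite (le_lt_trans (qD _ _))// [ltRHS](splitr e) ltr_leD// yA.
Qed.

End LocallyConvexTheory.

Theorem theorem2p7 (R : realType) (k : scalar_kind)
    (X : tvsType (scalars R k)) (Gamma : set (X -> R))
    (T : R -> continuous_operator X) :
  hausdorff_space X -> determining_system Gamma -> montel X ->
  C0_semigroup T -> bounded_semigroup Gamma T ->
  (uniformly_stable Gamma T <-> strongly_stable T).
Proof.
move=> _ detG [barX compactX] _ bT.
have [semiG _] := detG.
split=> [unifT x|strongT B q bB Gq].
  apply: determining_system_cvg0 detG _ => q e Gq e0.
  have [sq cq] := semiG q Gq.
  (* Uniform stability on the bounded set [[set x]] dominates the orbit of [x]. *)
  have /cvgr_lt/(_ _ e0) := unifT _ _ (bounded_set1 x) Gq.
  apply: filterS => t; apply: le_lt_trans.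
  exact: le_sup_seminorm (bounded_set1 x) _.
have [sq cq] := semiG q Gq.
apply/cvgrPdist_lt => e e0.
have e20 : 0 < e / 2 by rewrite divr_gt0.
(* The estimate is made on [closure B], which is compact by the Montel property. *)
have near_lt : \forall t \near +oo, forall x, closure B x -> q (T t x) < e / 2.
  apply: (@equicontinuous_near_compact _ _ _ _ +oo [set t | 0 <= t] T q) => //.
  - exact: nbhs_pinfty_ge.
  - move=> d d0; apply: barrelled_equicontinuous => // x.
    (* Here [C] depends on [x]; barrelledness upgrades these pointwise bounds to equicontinuity. *)
    have [C _ TC] := bT _ _ (bounded_set1 x) Gq.
    exists C => t /TC; apply: le_trans.
    exact: le_sup_seminorm (bounded_set1 x) _.
  - by move=> x d d0; exact: (strongT x _ (seminorm_near0 sq cq d0)).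
  - exact: compactX.
apply: filterS near_lt => t Bt.
rewrite sub0r normrN ger0_norm ?sup_seminorm_ge0//.
(* Strict bounds on the elements give only a non-strict bound on their supremum, hence the margin
   [e / 2]. *)
apply: (@le_lt_trans _ _ (e / 2)).
  by apply: sup_seminorm_le (ltW e20) _ => x Bx; apply/ltW/Bt/subset_closure.
by rewrite ltr_pdivrMr// ltr_pMr// ltr1n.
Qed.
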